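(* Let $0<q<1$ and let $\{p_n(z;q)\}_{n\in\mathbb N_0}$ be an odd $q$-Lidstone polynomial sequence of type I with associated numerical sequence $(\alpha_{2n})_{n\ge 0}$, and let $(\beta_{2n})_{n\ge0}$ be the numerical sequence determined by $(\alpha_{2n})_n$ as in the context. Then $p_0(z;q)=\frac1{\beta_0}z$ and, for $n\ge1$, $$p_n(z;q)=\frac{(-1)^n}{[3]_q!\,[5]_q!\cdots[2n-1]_q!\;\beta_0^{\,n+1}}\;\det\begin{bmatrix} z & z^3 & z^5&\cdots & z^{2n-1}& z^{2n+1}\\ \beta_0&\beta_2&\beta_4&\cdots&\beta_{2(n-1)}&\beta_{2n}\\ 0&[3]_q!\,\beta_0&\frac{[5]_q!}{[3]_q!}\beta_2&\cdots&\frac{[2n-1]_q!}{[2n-3]_q!}\beta_{2(n-2)}&\frac{[2n+1]_q!}{[2n-1]_q!}\beta_{2(n-1)}\\ \vdots&&\ddots&&\vdots&\vdots\\ 0&\cdots&\cdots&0&[2n-1]_q!\,\beta_0&\frac{[2n+1]_q!}{[3]_q!}\beta_2\end{bmatrix}.$$ Explicitly, the matrix is $(n+1)\times(n+1)$ with columns indexed by $i=0,\dots,n$; its first row has entries $z^{2i+1}$; its second row has entries $\beta_{2i}$; and for $k=1,\dots,n-1$ its $(k+2)$-nd row has entries $\frac{[2i+1]_q!}{[2(i-k)+1]_q!}\,\beta_{2(i-k)}$ for $i\ge k$ and $0$ for $i<k$. (The product $[3]_q!\cdots[2n-1]_q!$ is $1$ for $n=1$.)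
   Context: Fix $0<q<1$. Put $[m]_q=\frac{1-q^m}{1-q}$, $[m]_q!=\prod_{j=1}^m[j]_q$, $[0]_q!=1$, and ${n \brack k}_q=\frac{[n]_q!}{[k]_q!\,[n-k]_q!}$ for $0\le k\le n$. $\mathbb N=\{1,2,\dots\}$, $\mathbb N_0=\mathbb N\cup\{0\}$. The Jackson $q$-derivative is $D_qf(z)=\frac{f(qz)-f(z)}{(q-1)z}$ for $z\ne0$ and $D_qf(0)=f'(0)$, so $D_qz^m=[m]_qz^{m-1}$. An odd $q$-Lidstone polynomial sequence of type I (class $q$OLS-I) is a sequence $\{p_n(z;q)\}_{n\in\mathbb N_0}$ of polynomials in $z$ with real coefficients such that $D_q^2p_n(z;q)=[2n+1]_q[2n]_q\,p_{n-1}(z;q)$ for $n\in\mathbb N$, $p_n(0;q)=0$ for $n\in\mathbb N_0$, and $p_0(z;q)=\alpha_0z$ with $\alpha_0\in\mathbb R\setminus\{0\}$. Its associated numerical sequence is $\alpha_{2n}:=D_qp_n(0;q)$, and $p_n(z;q)=\sum_{k=0}^n {2n+1 \brack 2k+1}_q\frac{\alpha_{2(n-k)}}{[2(n-k)+1]_q}z^{2k+1}$. The sequence $(\beta_{2n})_{n\ge0}$ is the unique real sequence with $\sum_{j=0}^n \frac{\beta_{2j}\,\alpha_{2(n-j)}}{[2j+1]_q!\,[2(n-j)+1]_q!}=\delta_{n0}$ for all $n\in\mathbb N_0$ (Kronecker delta). *)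

(* Defs.v *)
From HB Require Import structures.
From mathcomp Require Import all_boot all_order all_algebra.
From mathcomp Require Import reals topology normedtype derive.

Set Implicit Arguments.
Unset Strict Implicit.
Unset Printing Implicit Defensive.

Import Order.TTheory GRing.Theory Num.Theory.
Import numFieldNormedType.Exports.

Local Open Scope ring_scope.

Definition qnum (R : realType) (q : R) (m : nat) : R := (1 - q ^+ m) / (1 - q).

Definition qfact (R : realType) (q : R) (m : nat) : R :=
  \prod_(1 <= j < m.+1) qnum q j.

Definition jackson_deriv (R : realType) (q : R) (f : R -> R) (z : R) : R :=
  if z == 0 then derive1 f 0 else (f (q * z) - f z) / ((q - 1) * z).

Definition odd_qLidstone_I (R : realType) (q : R) (p : nat -> {poly R}) : Prop :=
  [/\ forall n : nat, (0 < n)%N -> forall z : R,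
        jackson_deriv q (jackson_deriv q (fun x => (p n).[x])) z =
          qnum q (2 * n + 1)%N * qnum q (2 * n)%N * (p n.-1).[z],
      forall n : nat, (p n).[0] = 0
    & exists2 a : R, a != 0 & p 0%N = a *: 'X].

(* Even-indexed sequences are reindexed by half the index: the value at n of
   the sequences alpha and beta below is alpha_{2n}, resp. beta_{2n}. *)
Definition assoc_seq (R : realType) (q : R) (p : nat -> {poly R}) (n : nat) : R :=
  jackson_deriv q (fun x => (p n).[x]) 0.

Definition conj_seq (R : realType) (q : R) (alpha beta : nat -> R) : Prop :=
  forall n : nat,
    \sum_(0 <= j < n.+1) beta j * alpha (n - j)%N /
        (qfact q (2 * j + 1)%N * qfact q (2 * (n - j) + 1)%N)
    = (n == 0%N)%:R.

(* The matrix has polynomial entries, the indeterminate 'X standing for z.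
   Row 1 is the case k = 0 of the general row formula, as [2i+1]_q! cancels. *)
Definition lidstone_mx (R : realType) (q : R) (beta : nat -> R) (n : nat) :
    'M[{poly R}]_n.+1 :=
  \matrix_(r < n.+1, i < n.+1)
    match nat_of_ord r with
    | 0%N => 'X^(2 * i + 1)
    | 1%N => (beta i)%:P
    | k.+1 =>
        if (k <= i)%N then
          (qfact q (2 * i + 1)%N / qfact q (2 * (i - k) + 1)%N
             * beta (i - k)%N)%:P
        else 0
    end.

(* Main.v *)
(* The recurrence for D_q^2 shifts the normalized coefficients of p_n, which
   gives the convolution p_n / [2n+1]_q! = sum_k a_{n-k} z^{2k+1} / [2k+1]_q!
   with a_i = alpha_{2i} / [2i+1]_q!. Dividing column i of the matrix by
   [2i+1]_q! leaves a Toeplitz matrix in b_i = beta_{2i} / [2i+1]_q!, bordered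
   by the row z^{2i+1} / [2i+1]_q!. As b is the convolution inverse of a, this
   matrix maps the vector (a_{n-i})_i to (p_n / [2n+1]_q!) e_0, and Cramer's
   rule on the last coordinate gives the determinant. *)
Require Import Defs.
From mathcomp Require Import all_boot all_order all_algebra.
From mathcomp Require Import boolp reals derive.
From mathcomp Require Import ring.

Set Implicit Arguments.
Unset Strict Implicit.
Unset Printing Implicit Defensive.

Import Order.TTheory GRing.Theory Num.Theory.
Local Open Scope ring_scope.

(** The difference [d] vanishes at the [size d] points 0, 1, 2, ..., which are distinct in
    characteristic zero. *)
Lemma poly_ext (R : numDomainType) (p r : {poly R}) :
  (forall x, p.[x] = r.[x]) -> p = r.
Proof.
move=> eqpr; apply/eqP; rewrite -subr_eq0; apply/eqP.
set d := p - r; pose s := [seq i%:R : R | i <- iota 0 (size d)].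
apply: (@roots_geq_poly_eq0 _ d s).
- by apply/allP => x _; rewrite /root !hornerE eqpr subrr.
- by rewrite map_inj_uniq ?iota_uniq // => i j /eqP; rewrite eqr_nat => /eqP.
- by rewrite size_map size_iota.
Qed.

(** Formal version of [jackson_deriv], which makes coefficients comparable. *)
Definition jackson_poly (R : realType) (q : R) (p : {poly R}) : {poly R} :=
  \poly_(i < (size p).-1) (qnum q i.+1 * p`_i.+1).

Lemma coef_jackson_poly (R : realType) (q : R) (p : {poly R}) (m : nat) :
  (jackson_poly q p)`_m = qnum q m.+1 * p`_m.+1.
Proof.
rewrite coef_poly; case: ltnP => // lepm.
have le_p : (size p <= m.+1)%N by rewrite (leq_trans (leqSpred _)).
by rewrite nth_default ?mulr0.
Qed.

Lemma jackson_horner (R : realType) (q : R) (p : {poly R}) : q != 1 ->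
  jackson_deriv q (horner p) = horner (jackson_poly q p).
Proof.
move=> q1; have q1' : 1 - q != 0 by rewrite subr_eq0 eq_sym.
apply/funext => z; rewrite /jackson_deriv; case: eqVneq => [->|z0].
  rewrite -derivE !horner_coef0 coef_jackson_poly coef_deriv.
  by rewrite /qnum expr1 divff ?mul1r.
have den0 : (q - 1) * z != 0 by rewrite mulf_neq0 ?subr_eq0.
apply: (canLR (mulfK den0)); rewrite horner_poly !horner_coef.
rewrite -sumrB; case: (size p) => [|s]; first by rewrite !big_ord0 mul0r.
(* The constant terms cancel in f(qz) - f(z), which produces the index shift. *)
rewrite big_ord_recl !expr0 subrr add0r mulr_suml.
apply: eq_bigr => i _; rewrite lift0 /=.
by rewrite exprMn /qnum [z ^+ _]exprS; field.
Qed.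

(** Cramer's rule in adjugate form: with [a 0] kept as a factor no division occurs, so the identity
    can be used over [{poly R}]. *)
Lemma det_bordered_toeplitz (R : comNzRingType) (a b y : nat -> R) (n : nat) :
  (forall m, \sum_(j < m.+1) b j * a (m - j)%N = (m == 0%N)%:R) ->
  \det (\matrix_(r < n.+1, i < n.+1)
          if r == 0%N :> nat then y i
          else if (r.-1 <= i)%N then b (i - r.-1)%N else 0) * a 0%N
  = (-1) ^+ n * b 0%N ^+ n * \sum_(i < n.+1) a (n - i)%N * y i.
Proof.
move=> hab; set N := \matrix_(_, _) _.
pose v : 'cV[R]_n.+1 := \col_i a (n - i)%N.
set S := \sum_(i < n.+1) _.
have Nv : N *m v = \col_i (if i == 0%N :> nat then S else 0).
  apply/colP => r; rewrite !mxE; case: eqP => [r0|/eqP r0].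
    by apply: eq_bigr => i _; rewrite !mxE r0 eqxx mulrC.
  (* Below the border, shifting the index by [r.-1] leaves the convolution at [n - r.-1], which is
     positive, so [hab] gives 0. *)
  have ltr : (r.-1 < n)%N by rewrite -ltnS prednK ?lt0n.
  transitivity (\sum_(0 <= i < n.+1)
      (if (r.-1 <= i)%N then b (i - r.-1)%N else 0) * a (n - i)%N).
    by rewrite big_mkord; apply: eq_bigr => i _; rewrite !mxE (negbTE r0).
  have ler : (r.-1 <= n.+1)%N by rewrite ltnW // ltnW.
  rewrite (big_cat_nat (leq0n _) ler) //= big_nat.
  rewrite big1 => [|i /andP[_ ltir]]; last first.
    by rewrite leqNgt ltir mul0r.
  rewrite add0r -{1}[r.-1]add0n big_addn subSn 1?ltnW //.
  have := hab (n - r.-1)%N; rewrite subn_eq0 leqNgt ltr; apply: etrans.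
  rewrite big_mkord; apply: eq_bigr => i _.
  by rewrite leq_addl addnK subnDA subnAC.
have /(congr1 (fun A : 'cV_n.+1 => A ord_max 0)) := mulmxA (\adj N) N v.
rewrite mul_adj_mx mul_scalar_mx Nv !mxE subnn => <-.
rewrite big_ord_recl !mxE /= big1 => [|i _]; last by rewrite !mxE mulr0.
rewrite addr0 /cofactor /= add0n; congr (_ * _ * _).
(* Without row 0 and the last column, [N] is upper triangular with [b 0] on the diagonal; [det_trig]
   wants the lower triangular transpose. *)
rewrite -det_tr det_trig.
  rewrite -[n in RHS]card_ord -prodr_const; apply: eq_bigr => i _.
  by rewrite !mxE lift0 lift_max /= leqnn subnn.
apply/is_trig_mxP => i j ltij.
by rewrite !mxE lift0 lift_max /= leqNgt ltij.
Qed.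

Lemma qnum_neq0 (R : realType) (q : R) (m : nat) :
  0 < q -> q < 1 -> (0 < m)%N -> qnum q m != 0.
Proof.
move=> q0 q1 m0; rewrite mulf_neq0 ?invr_eq0 ?subr_eq0 ?(gt_eqF q1) //.
by rewrite gt_eqF // exprn_ilt1 // ?ltW // -lt0n.
Qed.

Lemma qfact_neq0 (R : realType) (q : R) (m : nat) :
  0 < q -> q < 1 -> qfact q m != 0.
Proof.
move=> q0 q1; rewrite /qfact prodf_seq_neq0; apply/allP => j.
by rewrite mem_index_iota => /andP[j0 _]; rewrite qnum_neq0.
Qed.

Lemma qfactS (R : realType) (q : R) (m : nat) :
  qfact q m.+1 = qnum q m.+1 * qfact q m.
Proof. by rewrite /qfact big_nat_recr //= mulrC. Qed.

Lemma qfact0 (R : realType) (q : R) : qfact q 0 = 1.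
Proof. by rewrite /qfact big_geq. Qed.

Lemma qfact1 (R : realType) (q : R) : q < 1 -> qfact q 1 = 1.
Proof.
move=> q1; rewrite qfactS qfact0 mulr1 /qnum expr1 divff //.
by rewrite subr_eq0 gt_eqF.
Qed.

Section OddLidstone.

Variables (R : realType) (q : R) (p : nat -> {poly R}).
Hypotheses (q0 : 0 < q) (q1 : q < 1) (hp : odd_qLidstone_I q p).

Let qN1 : q != 1. Proof. by rewrite lt_eqF. Qed.

Lemma odd_qLidstone_coef_rec n m :
  qnum q m.+2 * qnum q m.+1 * (p n.+1)`_m.+2 =
  qnum q (2 * n.+1 + 1)%N * qnum q (2 * n.+1)%N * (p n)`_m.
Proof.
have [hD _ _] := hp.
have: jackson_poly q (jackson_poly q (p n.+1)) =
      (qnum q (2 * n.+1 + 1)%N * qnum q (2 * n.+1)%N) *: p n.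
  apply: poly_ext => z; rewrite hornerZ -(hD n.+1) //.
  by rewrite -!jackson_horner.
move/(congr1 (fun r : {poly R} => r`_m)).
by rewrite coefZ !coef_jackson_poly mulrCA mulrA.
Qed.

Lemma assoc_seqE n : assoc_seq q p n = (p n)`_1.
Proof.
rewrite /assoc_seq jackson_horner // horner_coef0 coef_jackson_poly.
by rewrite /qnum expr1 divff ?mul1r // subr_eq0 eq_sym.
Qed.

(* Dividing by [2n+1]_q!/[m]_q! turns the recurrence on the coefficients into
   the shift (n+1, m+2) |-> (n, m). *)
Lemma odd_qLidstone_coef_shift n m :
  (p n.+1)`_m.+2 * qfact q m.+2 / qfact q (2 * n.+1 + 1)%N =
  (p n)`_m * qfact q m / qfact q (2 * n + 1)%N.
Proof.
have := odd_qLidstone_coef_rec n m.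
have -> : (2 * n.+1 + 1 = (2 * n + 1).+2)%N by rewrite mulnS.
have -> : (2 * n.+1 = (2 * n + 1).+1)%N by rewrite mulnS addn1.
rewrite !qfactS => eqc.
have f0 := qfact_neq0 (2 * n + 1)%N q0 q1.
have u0 := @qnum_neq0 _ q (2 * n + 1).+2 q0 q1 isT.
have v0 := @qnum_neq0 _ q (2 * n + 1).+1 q0 q1 isT.
set u := qnum q (2 * n + 1).+2 in eqc u0 *.
set v := qnum q (2 * n + 1).+1 in eqc v0 *.
rewrite [X in X / _](_ : _ = u * v * (p n)`_m * qfact q m); last first.
  by rewrite -eqc; ring.
by field; rewrite f0 u0 v0.
Qed.

Lemma odd_qLidstone_coef0 n : (p n)`_0 = 0.
Proof. by have [_ h0 _] := hp; rewrite -horner_coef0. Qed.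

(** Induction step shared by the degree bound and the parity of [p n]. *)
Lemma odd_qLidstone_coef_vanish n m : (p n)`_m = 0 -> (p n.+1)`_m.+2 = 0.
Proof.
move=> pnm.
have k0 : qnum q m.+2 * qnum q m.+1 != 0 by rewrite mulf_neq0 ?qnum_neq0.
by apply: (mulfI k0); rewrite odd_qLidstone_coef_rec pnm !mulr0.
Qed.

Lemma odd_qLidstone_coef_gt n m : (2 * n + 1 < m)%N -> (p n)`_m = 0.
Proof.
have [_ _ [a _ p0E]] := hp.
elim: n m => [|n IHn] [|[|m]] // ltm; first by rewrite p0E coefZ coefX mulr0.
apply/odd_qLidstone_coef_vanish/IHn.
by move: ltm; rewrite mulnS.
Qed.

(** The step to [m.+2] never reaches index 0; there the condition p_n(0) = 0 applies. *)
Lemma odd_qLidstone_coef_even n m : ~~ odd m -> (p n)`_m = 0.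
Proof.
have [_ _ [a _ p0E]] := hp.
elim: n m => [|n IHn] [|[|m]] //= evenm; rewrite ?odd_qLidstone_coef0 //.
  by rewrite p0E coefZ coefX mulr0.
by apply/odd_qLidstone_coef_vanish/IHn; rewrite negbK in evenm.
Qed.

(** Applying the shift [k] times moves (n, 2k+1) to (n-k, 1), and the linear coefficient is the
    value of [assoc_seq]. *)
Lemma odd_qLidstone_coef_odd n k : (k <= n)%N ->
  (p n)`_(2 * k + 1) * qfact q (2 * k + 1)%N / qfact q (2 * n + 1)%N =
  assoc_seq q p (n - k)%N / qfact q (2 * (n - k) + 1)%N.
Proof.
elim: k n => [|k IHk] [|n] //.
- by rewrite assoc_seqE qfact1 // mulr1.
- by rewrite assoc_seqE qfact1 // mulr1 subn0.
rewrite ltnS => lekn.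
rewrite subSS -IHk // -(odd_qLidstone_coef_shift n (2 * k + 1)).
by have -> : (2 * k.+1 + 1 = (2 * k + 1).+2)%N by rewrite mulnS.
Qed.

Lemma odd_qLidstone_expansion n :
  p n = qfact q (2 * n + 1)%N *:
    \sum_(k < n.+1) (assoc_seq q p (n - k)%N / qfact q (2 * (n - k) + 1)%N)%:P
                    * ((qfact q (2 * k + 1)%N)^-1 *: 'X^(2 * k + 1)).
Proof.
apply/polyP => m; rewrite coefZ coef_sum.
under eq_bigr => k _ do rewrite coefCM coefZ coefXn.
(* Both sides vanish for even [m] and for odd [m] above 2n+1; otherwise only the term k = [m./2]
   contributes. *)
have [oddm|evenm] := boolP (odd m); last first.
  rewrite odd_qLidstone_coef_even // big1 ?mulr0 // => k _.
  case: eqP => [mE|_]; last by rewrite !mulr0.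
  by move: evenm; rewrite mE mul2n addn1 /= odd_double.
have mE : m = (2 * m./2 + 1)%N.
  by rewrite -{1}[m]odd_double_half oddm mul2n addnC.
have [lemn|ltnm] := leqP m./2 n; last first.
  rewrite odd_qLidstone_coef_gt; last by rewrite mE ltn_add2r ltn_pmul2l.
  rewrite big1 ?mulr0 // => k _.
  case: eqP => [mkE|_]; last by rewrite !mulr0.
  move: ltnm; rewrite mkE mul2n addn1 /= uphalf_double ltnNge.
  by rewrite -ltnS ltn_ord.
rewrite (bigD1 (Ordinal (lemn : m./2 < n.+1)%N)) //= -mE eqxx mulr1.
rewrite big1 ?addr0 => [|k neqk]; last first.
  case: eqP => [mkE|_]; last by rewrite !mulr0.
  case/eqP: neqk; apply: val_inj => /=.
  by rewrite mkE mul2n addn1 /= uphalf_double.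
rewrite -odd_qLidstone_coef_odd // -mE.
by field; rewrite !qfact_neq0.
Qed.

End OddLidstone.

(** Column [i] carries the common factor [2i+1]_q!; pulling it out leaves the shape required by
    [det_bordered_toeplitz]. *)
Lemma lidstone_mx_factor (R : realType) (q : R) (beta : nat -> R) (n : nat) :
  0 < q -> q < 1 ->
  lidstone_mx q beta n =
  (\matrix_(r < n.+1, i < n.+1)
     if r == 0%N :> nat then (qfact q (2 * i + 1)%N)^-1 *: 'X^(2 * i + 1)
     else if (r.-1 <= i)%N
          then (beta (i - r.-1)%N / qfact q (2 * (i - r.-1) + 1)%N)%:P else 0)
  *m diag_mx (\row_(i < n.+1) (qfact q (2 * i + 1)%N)%:P).
Proof.
move=> q0 q1; have f0 m := qfact_neq0 m q0 q1.
apply/matrixP => r i; rewrite mul_mx_diag !mxE.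
case: r => -[|[|k]] ltr //=.
- by rewrite mulrC mul_polyC scalerA divff // scale1r.
- by rewrite subn0 -polyCM divfK.
- by case: leqP => _; rewrite ?mul0r // -polyCM mulrC mulrA mulrAC.
Qed.

Theorem theorem2p17 (R : realType) (q : R) (hq0 : 0 < q) (hq1 : q < 1)
    (p : nat -> {poly R}) (hp : odd_qLidstone_I q p)
    (beta : nat -> R) (hbeta : conj_seq q (assoc_seq q p) beta) :
  p 0%N = (beta 0%N)^-1 *: 'X /\
  forall n : nat, (1 <= n)%N ->
    p n = ((-1) ^+ n /
             ((\prod_(1 <= j < n) qfact q (2 * j + 1)%N) * beta 0%N ^+ n.+1))
          *: \det (lidstone_mx q beta n).
Proof.
have f0 m := qfact_neq0 m hq0 hq1; have f1 := qfact1 hq1.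
pose a i := (assoc_seq q p i / qfact q (2 * i + 1)%N)%:P.
pose b i := (beta i / qfact q (2 * i + 1)%N)%:P.
have hab m : \sum_(j < m.+1) b j * a (m - j)%N = (m == 0%N)%:R.
  rewrite -[RHS]polyC_natr -hbeta big_mkord raddf_sum; apply: eq_bigr => j _.
  by rewrite -polyCM; congr (_%:P); field; rewrite !f0.
(* The convolution at index 0 makes beta_0 invertible, with inverse alpha_0. *)
have ba0 : beta 0%N * assoc_seq q p 0%N = 1.
  have := hbeta 0%N; rewrite big_nat1 /= f1 mulr1 divr1; exact.
have b0 : beta 0%N != 0.
  by apply: contra_eqN ba0 => /eqP->; rewrite mul0r eq_sym oner_eq0.
have a0E : assoc_seq q p 0%N = (beta 0%N)^-1.
  by rewrite -[RHS]mulr1 -ba0 mulKf.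
split=> [|n n0].
  rewrite (odd_qLidstone_expansion hq0 hq1 hp) big_ord1 !f1 scale1r.
  by rewrite invr1 scale1r mulr1 sub0n a0E mul_polyC.
rewrite [p n](odd_qLidstone_expansion hq0 hq1 hp) lidstone_mx_factor //.
rewrite det_mulmx det_diag.
set N := \matrix_(_, _) _; set S := \sum_(_ < n.+1) _.
(* Multiplying by [b 0] cancels [a 0] and raises the exponent of beta_0 from n to n+1. *)
have detN : \det N = ((-1) ^+ n * beta 0%N ^+ n.+1) *: S.
  have /(congr1 (fun r => b 0%N * r)) := @det_bordered_toeplitz _ a b
    (fun i => (qfact q (2 * i + 1)%N)^-1 *: 'X^(2 * i + 1)) n hab.
  have -> : b 0%N = (beta 0%N)%:P by rewrite /b f1 divr1.
  have -> : a 0%N = ((beta 0%N)^-1)%:P by rewrite /a f1 divr1 a0E.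
  rewrite -/N -/S mulrCA -polyCM divff // mulr1 => ->.
  rewrite -mul_polyC exprS !polyCM !polyC_exp polyCN; ring.
(* The factor i = 0 is [1]_q! = 1; the factor i = n is split off to match the scalar [2n+1]_q! of
   the expansion. *)
have -> : \prod_(i < n.+1) (\row_(i < n.+1) (qfact q (2 * i + 1)%N)%:P) 0 i =
    (\prod_(1 <= j < n) qfact q (2 * j + 1)%N * qfact q (2 * n + 1)%N)%:P.
  transitivity (\prod_(0 <= i < n.+1) (qfact q (2 * i + 1)%N)%:P).
    by rewrite big_mkord; apply: eq_bigr => i _; rewrite mxE.
  rewrite -rmorph_prod big_nat_recr //= big_ltn // f1 mul1r //.
rewrite detN [_ * _%:P]mulrC mul_polyC !scalerA; congr (_ *: _).
have P0 : \prod_(1 <= j < n) qfact q (2 * j + 1)%N != 0.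
  by rewrite prodf_seq_neq0; apply/allP => j _; rewrite f0.
(* The sign occurs twice, in the prefactor and in [detN]; fixing its value lets [field] see that its
   square is 1. *)
have [->|->] : (-1) ^+ n = 1 :> R \/ (-1) ^+ n = -1 :> R.
  by rewrite -signr_odd; case: odd; [right|left].
all: by field; rewrite P0 expf_neq0.
Qed.
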